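(* Let $\Gamma_1$ and $\Gamma_2$ be two nontrivial groups, generated respectively by finite symmetric sets $S_1$ and $S_2$. Let $\Gamma=\Gamma_1*\Gamma_2$ (free product) with the generating set $S=S_1\cup S_2$ and the corresponding word distance. There exists on $\Gamma$ a (nonsymmetric, nonadmissible) probability measure $\mu$, with an exponential moment and nonzero entropy $h(\mu)$, satisfying $h(\mu)=\ell(\mu)v$, where $v$ is the exponential growth rate of $\Gamma$ for this word distance.
   Context: Write $e$ for the identity, $d$ for the word distance associated to $S$, $|g|=d(e,g)$, $B_n=\{g\in\Gamma: |g|\le n\}$, and $v=\liminf_{n\to\infty}\frac{\log|B_n|}{n}$, where $|B_n|$ is the cardinality of $B_n$. A probability measure $\mu$ on $\Gamma$ has an exponential moment if $\sum_g\mu(g)e^{s|g|}<\infty$ for some $s>0$. It is symmetric if $\mu(g)=\mu(g^{-1})$ for all $g$, and admissible if the semigroup generated by its support is $\Gamma$. Let $\mu^{*n}$ be the $n$-th convolution power of $\mu$, $L(\mu)=\sum_g\mu(g)|g|$, $H(\mu)=\sum_g\mu(g)(-\log\mu(g))$ (with $0\log 0=0$), $\ell(\mu)=\lim_n L(\mu^{*n})/n$ (drift) and $h(\mu)=\lim_n H(\mu^{*n})/n$ (asymptotic entropy); the limits exist by subadditivity.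
   Formalization: The groups Γ_1 and Γ_2 are assumed not to be both of order 2; in that case Γ is infinite dihedral, v = 0 and ℓ(μ) is finite, so h(μ) = ℓ(μ)v would force zero entropy and the claim is false. *)

(* Defs.v *)
From HB Require Import structures.
From mathcomp Require Import all_boot all_order all_algebra.
From mathcomp Require Import finmap.
From mathcomp Require Import all_classical all_reals all_analysis.

Set Implicit Arguments.
Unset Strict Implicit.
Unset Printing Implicit Defensive.

Import Order.TTheory GRing.Theory Num.Theory.
Import numFieldNormedType.Exports.

Section FreeProduct.
Variables G1 G2 : groupType.
Local Open Scope group_scope.

Definition letter : Type := (G1 + G2)%type.
Implicit Types (x y : letter) (u v w : seq letter).

Definition letter_trivial x : bool :=
  match x with inl a => a == 1 | inr b => b == 1 end.

Definition same_factor x y : bool :=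
  match x, y with inl _, inl _ | inr _, inr _ => true | _, _ => false end.

Definition reduced w : bool :=
  all (fun x => ~~ letter_trivial x) w &&
  sorted (fun x y => ~~ same_factor x y) w.

(* Left multiplication of a reduced word by one letter, returning a reduced
   word. *)
Definition lmul x w : seq letter :=
  match x, w with
  | inl a, inl b :: w' => if a * b == 1 then w' else inl (a * b) :: w'
  | inr a, inr b :: w' => if a * b == 1 then w' else inr (a * b) :: w'
  | _, _ => if letter_trivial x then w else x :: w
  end.

Definition wmul u v : seq letter := foldr lmul v u.

Definition linv x : letter :=
  match x with inl a => inl a^-1 | inr b => inr b^-1 end.

Definition winv w : seq letter := rev (map linv w).

Lemma reduced_behead x w : reduced (x :: w) -> reduced w.
Proof. by case/andP => /= /andP[_ h] /path_sorted hs; rewrite /reduced h. Qed.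

Lemma lmul_reduced x w : reduced w -> reduced (lmul x w).
Proof.
rewrite /reduced; case: x w => [a|a] [|[b|b] w] //=;
  do 1?[case: ifPn => //= h]; rewrite ?h //=;
  case/andP => /andP[h1 h2] h3; rewrite ?h1 ?h2 ?h3 ?(path_sorted h3) //=;
  by case: w h2 h3 => [|[c|c] w].
Qed.

Lemma wmul_reduced u v : reduced v -> reduced (wmul u v).
Proof. by move=> hv; elim: u => //= x u; exact: lmul_reduced. Qed.

Lemma lmul_id x w : letter_trivial x -> reduced w -> lmul x w = w.
Proof.
case: x w => [a|a] [|[b|b] w] //= /eqP ->; rewrite ?eqxx //.
all: by rewrite mul1g => /andP[/= /andP[/negbTE -> _] _].
Qed.

Lemma lmul_inl a b w : reduced w ->
  lmul (inl a) (lmul (inl b) w) = lmul (inl (a * b)) w.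
Proof.
case: w => [|[c|c] w] hw /=.
- have [->|hb] := eqVneq b 1; first by rewrite mulg1.
  by [].
- have [hbc|hbc] := eqVneq (b * c) 1.
    rewrite -mulgA hbc mulg1.
    case: w hw => [|[d|d] w] //= hw; by case/andP: hw.
  by rewrite /= mulgA.
- have [->|hb] := eqVneq b 1; first by rewrite mulg1.
  by [].
Qed.

Lemma lmul_inr a b w : reduced w ->
  lmul (inr a) (lmul (inr b) w) = lmul (inr (a * b)) w.
Proof.
case: w => [|[c|c] w] hw /=.
- have [->|hb] := eqVneq b 1; first by rewrite mulg1.
  by [].
- have [->|hb] := eqVneq b 1; first by rewrite mulg1.
  by [].
- have [hbc|hbc] := eqVneq (b * c) 1.
    rewrite -mulgA hbc mulg1.
    case: w hw => [|[d|d] w] //= hw; by case/andP: hw.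
  by rewrite /= mulgA.
Qed.

Lemma wmul_lmul x v w : reduced v -> reduced w ->
  wmul (lmul x v) w = lmul x (wmul v w).
Proof.
move=> hv hw.
have hz v' : reduced (wmul v' w) by exact: wmul_reduced.
have wmul_cons x' v' : wmul (x' :: v') w = lmul x' (wmul v' w) by [].
have triv x' v' : wmul (if letter_trivial x' then v' else x' :: v') w
    = lmul x' (wmul v' w).
  by case: ifPn => h; rewrite ?wmul_cons // lmul_id.
case: x v hv => [a|a] [|[b|b] v] hv; rewrite ?wmul_cons; try exact: triv.
  rewrite lmul_inl // [lmul _ _]/=; case: ifPn => h //.
  by rewrite lmul_id.
rewrite lmul_inr // [lmul _ _]/=; case: ifPn => h //.
by rewrite lmul_id.
Qed.

Lemma wmulA u v w : reduced v -> reduced w ->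
  wmul u (wmul v w) = wmul (wmul u v) w.
Proof.
move=> hv hw; elim: u => //= x u ->.
by rewrite wmul_lmul //; exact: wmul_reduced.
Qed.

Lemma wmul_nil u : reduced u -> wmul u [::] = u.
Proof.
elim: u => //= x u IHu hxu; rewrite IHu; last exact: reduced_behead hxu.
case: x u hxu {IHu} => [a|a] [|[b|b] u] /=; rewrite /reduced /=.
all: by case: (a =P 1) => //= _; rewrite ?andbF.
Qed.

Lemma lmul_linv x u : reduced (x :: u) -> lmul (linv x) (x :: u) = u.
Proof. by case: x => a _ /=; rewrite mulVg eqxx. Qed.

Lemma wmulV u : reduced u -> wmul (winv u) u = [::].
Proof.
elim: u => //= x u IHu hxu.
rewrite /wmul /winv /= rev_cons -cats1 foldr_cat /= lmul_linv //.
by apply: IHu; exact: reduced_behead hxu.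
Qed.

Lemma linvK : involutive linv.
Proof. by case=> a /=; rewrite invgK. Qed.

Lemma winvK : involutive winv.
Proof. by move=> u; rewrite /winv map_rev revK mapK //; exact: linvK. Qed.

Lemma winv_reduced u : reduced u -> reduced (winv u).
Proof.
case/andP => h1 h2; apply/andP; split.
  rewrite /winv all_rev all_map; apply: sub_all h1 => x /=.
  by case: x => a /=; rewrite eqg_invLR invg1.
rewrite /winv rev_sorted sorted_map; apply: sub_sorted h2.
by case=> a [b|b].
Qed.

(* The free product, realized as the group of reduced words; it satisfies the
   universal property [fp_universal] below. *)
Record free_product := FreeProduct {
  word_of : seq letter;
  word_of_reduced : reduced word_of }.

HB.instance Definition _ := [isSub for word_of].
HB.instance Definition _ := [Choice of free_product by <:].

Implicit Types g h k : free_product.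

Definition fp_one := FreeProduct (erefl : reduced [::]).
Definition fp_mul g h :=
  FreeProduct (wmul_reduced (word_of g) (word_of_reduced h)).
Definition fp_inv g := FreeProduct (winv_reduced (word_of_reduced g)).

Lemma fp_mulA : associative fp_mul.
Proof. by move=> [u hu] [v hv] [w hw]; apply: val_inj => /=; exact: wmulA. Qed.

Lemma fp_mul1 : left_id fp_one fp_mul.
Proof. by move=> [u hu]; exact: val_inj. Qed.

Lemma fp_mulr1 : right_id fp_one fp_mul.
Proof. by move=> [u hu]; apply: val_inj => /=; exact: wmul_nil. Qed.

Lemma fp_mulV : left_inverse fp_one fp_inv fp_mul.
Proof. by move=> [u hu]; apply: val_inj => /=; exact: wmulV. Qed.

Lemma fp_mulrV : right_inverse fp_one fp_inv fp_mul.
Proof.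
move=> [u hu]; apply: val_inj => /=.
by rewrite -{1}(winvK u); apply: wmulV; exact: winv_reduced.
Qed.

HB.instance Definition _ := isGroup.Build free_product
  fp_mulA fp_mul1 fp_mulr1 fp_mulV fp_mulrV.

Definition fp_inl (a : G1) : free_product :=
  FreeProduct (lmul_reduced (inl a) (erefl : reduced [::])).
Definition fp_inr (b : G2) : free_product :=
  FreeProduct (lmul_reduced (inr b) (erefl : reduced [::])).

Lemma fp_inl_mulE a g : fp_inl a * g =
  FreeProduct (lmul_reduced (inl a) (word_of_reduced g)).
Proof.
apply: val_inj; exact: (wmul_lmul (inl a) (v := [::]) erefl (word_of_reduced g)).
Qed.

Lemma fp_inr_mulE b g : fp_inr b * g =
  FreeProduct (lmul_reduced (inr b) (word_of_reduced g)).
Proof.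
apply: val_inj; exact: (wmul_lmul (inr b) (v := [::]) erefl (word_of_reduced g)).
Qed.

Lemma fp_inlM : {morph fp_inl : a b / a * b}.
Proof.
by move=> a b; rewrite fp_inl_mulE; apply: val_inj; rewrite -[LHS]lmul_inl.
Qed.

Lemma fp_inrM : {morph fp_inr : a b / a * b}.
Proof.
by move=> a b; rewrite fp_inr_mulE; apply: val_inj; rewrite -[LHS]lmul_inr.
Qed.

Lemma fp_inl_inj : injective fp_inl.
Proof.
move=> a b /(congr1 word_of) /=.
by have [->|_] := eqVneq a 1; have [->|_] := eqVneq b 1 => // -[].
Qed.

Lemma fp_inr_inj : injective fp_inr.
Proof.
move=> a b /(congr1 word_of) /=.
by have [->|_] := eqVneq a 1; have [->|_] := eqVneq b 1 => // -[].
Qed.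

Definition fp_letter x : free_product :=
  match x with inl a => fp_inl a | inr b => fp_inr b end.

Lemma fp_wordE g : g = \prod_(x <- word_of g) fp_letter x.
Proof.
case: g => w hw /=; elim: w hw => [|x w IHw] hw.
  by rewrite big_nil; exact: val_inj.
have hw' := reduced_behead hw.
rewrite big_cons -(IHw hw'); apply: val_inj.
have /= := wmul_nil hw; rewrite wmul_nil // => <-.
by case: x {hw} => a; rewrite -(wmul_lmul _ (v := [::]) erefl hw').
Qed.

Lemma fp_universal (H : groupType) (f1 : G1 -> H) (f2 : G2 -> H) :
    {morph f1 : x y / x * y} -> {morph f2 : x y / x * y} ->
  exists! f : free_product -> H,
    [/\ {morph f : x y / x * y}, f \o fp_inl = f1 & f \o fp_inr = f2].
Proof.
move=> f1M f2M.
have f11 : f1 1 = 1 by apply: (@mulgI _ (f1 1)); rewrite -f1M !mulg1.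
have f21 : f2 1 = 1 by apply: (@mulgI _ (f2 1)); rewrite -f2M !mulg1.
pose fl x := match x with inl a => f1 a | inr b => f2 b end.
pose f g := \prod_(x <- word_of g) fl x.
have f_lmul x w : \prod_(y <- lmul x w) fl y = fl x * \prod_(y <- w) fl y.
  case: x w => [a|a] [|[b|b] w] /=; case: eqP => h;
    rewrite ?big_cons ?big_nil /= ?h ?f11 ?f21 ?mul1g //.
  - by rewrite mulgA -f1M h f11 mul1g.
  - by rewrite mulgA -f1M.
  - by rewrite mulgA -f2M h f21 mul1g.
  - by rewrite mulgA -f2M.
have fM : {morph f : x y / x * y}.
  move=> [u hu] [v hv]; rewrite /f /=; elim: u {hu} => [|x u IHu] /=.
    by rewrite big_nil mul1g.
  by rewrite f_lmul IHu big_cons mulgA.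
exists f; split.
  split=> //; apply/funext => a; rewrite /f /=.
    by case: eqP => [->|_]; rewrite ?big_nil ?f11 // big_seq1.
  by case: eqP => [->|_]; rewrite ?big_nil ?f21 // big_seq1.
move=> f' [f'M f'1 f'2]; apply/funext => g.
have f'one : f' 1 = 1 by apply: (@mulgI _ (f' 1)); rewrite -f'M !mulg1.
rewrite {2}(fp_wordE g) (big_morph f' f'M f'one) /f; apply: eq_bigr => -[a|a] _ /=.
  by rewrite -f'1.
by rewrite -f'2.
Qed.

End FreeProduct.

Section WordMetric.
Variable G : groupType.
Implicit Types (S : set G) (x y g : G) (n : nat).
Local Open Scope classical_set_scope.
Local Open Scope group_scope.

Definition symmetric_set S : Prop := forall s, S s -> S s^-1.

(* For symmetric [S] the products of elements of [S] form the subgroup generated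
   by [S]. *)
Definition generates S : Prop :=
  forall g, exists2 s : seq G, [set` s] `<=` S & g = \prod_(a <- s) a.

Definition joined S n x y : Prop :=
  exists s : seq G, [/\ size s = n, [set` s] `<=` S & y = x * \prod_(a <- s) a].

(* Junk value [0] when [y] cannot be reached from [x]; this does not occur when
   [S] generates [G]. *)
Definition word_dist S x y : nat :=
  if pselect (exists n, `[< joined S n x y >]) is left h then ex_minn h else 0%N.

Definition word_norm S g : nat := word_dist S 1 g.

Definition word_ball S n : set G := [set g | (word_norm S g <= n)%N].

End WordMetric.

Definition growth_rate (R : realType) (G : groupType) (S : set G) : \bar R :=
  limn_einf (fun n : nat =>
    (ln (#|` fset_set (word_ball S n)|%fset%:R : R) / n%:R)%:E)%R.

Definition free_product_gen (G1 G2 : groupType) (S1 : set G1) (S2 : set G2) :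
    set (free_product G1 G2) :=
  (@fp_inl G1 G2 @` S1 `|` @fp_inr G1 G2 @` S2)%classic.

(* A probability measure on a discrete group is encoded by its point masses
   [mu : G -> R]. *)
Section Measures.
Variables (R : realType) (G : groupType).
Implicit Types (mu nu : G -> R) (S : set G).
Local Open Scope classical_set_scope.
Local Open Scope ring_scope.

Definition is_probability mu : Prop :=
  (forall g, 0 <= mu g) /\ \esum_(g in [set: G]) (mu g)%:E = 1%E.

Definition has_exponential_moment S mu : Prop :=
  exists2 s : R, 0 < s &
    (\esum_(g in [set: G]) (mu g * expR (s * (word_norm S g)%:R))%:E < +oo)%E.

Definition symmetric_measure mu : Prop := forall g, mu g = mu (g^-1)%g.

Definition semigroup_generated (A : set G) : set G :=
  [set g | exists s : seq G,
     [/\ s != [::], [set` s] `<=` A & g = (\prod_(a <- s) a)%g]].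

Definition admissible mu : Prop :=
  semigroup_generated [set g | mu g != 0] = [set: G].

Definition convolution mu nu : G -> R := fun g =>
  fine (\esum_(x in [set: G]) (mu x * nu (x^-1 * g)%g)%:E).

Definition convolution_power mu (n : nat) : G -> R :=
  iter n (convolution mu) (fun g => (g == 1%g)%:R).

Definition mean_length S mu : \bar R :=
  \esum_(g in [set: G]) (mu g * (word_norm S g)%:R)%:E.

(* The library sets [ln 0 = 0], in agreement with [0 log 0 = 0]. *)
Definition entropy mu : \bar R :=
  \esum_(g in [set: G]) (mu g * - ln (mu g))%:E.

Definition drift S mu : \bar R :=
  limn (fun n : nat =>
    ((n%:R^-1)%:E * mean_length S (convolution_power mu n))%E).

Definition asymptotic_entropy mu : \bar R :=
  limn (fun n : nat => ((n%:R^-1)%:E * entropy (convolution_power mu n))%E).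

End Measures.

(* Main.v *)
(* Let F_i(x) be the sum of x^|a| over the nontrivial elements a of Gamma_i.
   The words of Gamma are alternating products of letters and the word norm of
   Gamma is the sum of the norms of the letters, so that the weights x^|g| are
   multiplicative along reduced words.  When F_1(x) F_2(x) = 1, the formula
   mu(a b) = x^(|a| + |b|), for a in Gamma_1 and b in Gamma_2 nontrivial,
   defines a probability measure, and mu^{*n} has mass x^|g| at each
   alternating word g of 2n letters starting in Gamma_1.  Hence
   H(mu^{*n}) = - ln x * L(mu^{*n}) for all n, and it remains to see that
   - ln x is the growth rate of Gamma: the sum of x^|g| over the words with k
   letters is bounded above independently of k, and equals 1 for even k, so
   |B_n| x^n grows at most linearly and the sum of x^|g| over Gamma diverges;
   by submultiplicativity of the spheres this forces |B_n| x^n >= 1.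

   The critical x is the supremum of {x | F_1(x) F_2(x) <= 1}.  It is
   attained by lower semicontinuity.  If the product were < 1 there, one could
   still increase x, because submultiplicativity of the spheres makes
   {x | F_i(x) < oo} open and because power series are convex.  The same
   openness gives the exponential moment. *)
Require Import Defs.
From mathcomp Require Import all_boot all_order all_algebra.
From mathcomp Require Import finmap.
From mathcomp Require Import all_classical all_reals all_analysis.
From mathcomp Require Import lra ring zify.

Set Implicit Arguments.
Unset Strict Implicit.
Unset Printing Implicit Defensive.

Import Order.TTheory GRing.Theory Num.Theory.
Import numFieldNormedType.Exports.

Local Open Scope classical_set_scope.
Local Open Scope ring_scope.

(** * Sums of extended reals over arbitrary index sets *)

Section ExtendedSums.
Variable R : realType.
Local Open Scope ereal_scope.

Lemma subset_esum (T : choiceType) (A B : set T) (f : T -> \bar R) :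
  A `<=` B -> \esum_(i in A) f i <= \esum_(i in B) f i.
Proof.
move=> AB; apply: ge_ereal_sup => _ [X [finX XA] <-].
by apply: ereal_sup_ubound; exists X => //; split=> //; exact: subset_trans AB.
Qed.

Lemma esumU_le (T : choiceType) (A B : set T) (f : T -> \bar R) :
  (forall i, 0 <= f i) ->
  \esum_(i in A `|` B) f i <= \esum_(i in A) f i + \esum_(i in B) f i.
Proof.
move=> f0; rewrite (esumID A) //; apply: leeD; apply: subset_esum.
  by move=> x [].
by move=> x [[]].
Qed.

Lemma esum_term_le (T : choiceType) (A : set T) (f : T -> \bar R) t :
  (forall i, 0 <= f i) -> A t -> f t <= \esum_(i in A) f i.
Proof.
move=> f0 At; rewrite -{1}(@esum_set1 R T t f) //; apply: subset_esum.
by move=> _ ->.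
Qed.

Lemma esumZl (T : choiceType) (A : set T) (c : \bar R) (f : T -> \bar R) :
  0 <= c -> (forall i, 0 <= f i) ->
  \esum_(i in A) (c * f i) = c * \esum_(i in A) f i.
Proof.
(* For a finite factor one inequality suffices: applied to the inverse factor, it gives the
   other. *)
have le_r (r : R) (g : T -> \bar R) : (0 <= r)%R -> (forall i, 0 <= g i) ->
    \esum_(i in A) (r%:E * g i) <= r%:E * \esum_(i in A) g i.
  move=> r0 g0; apply: ge_ereal_sup => _ [X [finX XA] <-].
  rewrite -ge0_mule_fsumr //; apply: lee_wpmul2l; rewrite ?lee_fin //.
  by apply: ereal_sup_ubound; exists X.
case: c => [r| |] // r0 f0.
  move: r0; rewrite lee_fin le_eqVlt => /orP[/eqP <-|r0].
    by rewrite mul0e esum1 // => i _; rewrite mul0e.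
  apply/eqP; rewrite eq_le le_r ?(ltW r0) //=.
  rewrite -[leRHS]mul1e -(mulfV (lt0r_neq0 r0)) EFinM -muleA.
  apply: lee_wpmul2l; first by rewrite lee_fin ltW.
  apply: le_trans (le_r (r^-1)%R (fun i => r%:E * f i) _ _); last first.
  - by move=> i; rewrite mule_ge0 // lee_fin ltW.
  - by rewrite invr_ge0 ltW.
  by apply: le_esum => i _; rewrite muleA -EFinM mulVf ?lt0r_neq0 // mul1e.
(* For an infinite factor, one positive term makes both sides infinite; otherwise all terms
   vanish. *)
have [[t At ft]|h] := pselect (exists2 t, A t & 0 < f t).
  rewrite gt0_mulye; last exact: lt_le_trans (esum_term_le f0 At).
  apply/eqP; rewrite -leye_eq -{1}(gt0_mulye ft).
  by apply: (@esum_term_le _ A (fun i => +oo * f i)) => // i; exact: mule_ge0.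
have fA i : A i -> f i = 0.
  move=> Ai; apply/eqP; rewrite eq_le f0 andbT leNgt; apply/negP => fi.
  by apply: h; exists i.
by rewrite [in RHS]esum1 // mule0 esum1 // => i Ai; rewrite fA // mule0.
Qed.

Lemma esum_esumM (T U : choiceType) (A : set T) (B : set U)
    (f : T -> \bar R) (g : U -> \bar R) :
  (forall i, 0 <= f i) -> (forall j, 0 <= g j) ->
  \esum_(i in A) \esum_(j in B) (f i * g j) =
  (\esum_(i in A) f i) * (\esum_(j in B) g j).
Proof.
move=> f0 g0; under eq_esum do rewrite esumZl // muleC.
by rewrite esumZl ?esum_ge0 // muleC.
Qed.

Lemma esum_cst (T : choiceType) (A : set T) (c : R) : finite_set A ->
  (0 <= c)%R -> \esum_(i in A) c%:E = (#|` fset_set A|%:R * c)%:E.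
Proof.
move=> finA c0; rewrite esum_fset //.
rewrite fsbig_finite //= sumEFin big_const_seq count_predT iter_addr_0.
by rewrite mulr_natl.
Qed.

Lemma esum_pinfty (T : choiceType) (A : nat -> set T) (f : T -> \bar R) :
  (forall i, 0 <= f i) -> trivIset setT A ->
  (forall n, 1 <= \esum_(i in A n) f i) -> \esum_(i in \bigcup_n A n) f i = +oo.
Proof.
move=> f0 tA A1; rewrite esum_bigcupT //; apply: eq_infty => r.
apply: le_trans (@le_esum R nat setT (cst 1) _ (fun n _ => A1 n)).
apply: (@esum_ge R nat setT).
exists `I_(Num.bound `|r|%R); first by split.
rewrite -fsbig_ord sumEFin sumr_const card_ord lee_fin.
by rewrite (le_trans (ler_norm r)) // ltW // archi_boundP.
Qed.

End ExtendedSums.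

(** * Word norms, geodesic splittings and finiteness of balls *)

Section WordNorm.
Variables (G : groupType) (S : set G).
Local Open Scope group_scope.
Local Notation norm := (word_norm S).

Lemma word_norm_le (s : seq G) :
  [set` s] `<=` S -> (norm (\prod_(a <- s) a) <= size s)%N.
Proof.
move=> sS; rewrite /word_norm /word_dist; case: pselect => // h.
case: ex_minnP => k _; apply; apply/asboolP.
by exists s; split=> //; rewrite mul1g.
Qed.

Lemma word_norm1 : norm 1 = 0%N.
Proof.
have := @word_norm_le [::]; rewrite big_nil leqn0 => h.
by apply/eqP/h.
Qed.

Hypothesis genS : generates S.

Lemma word_norm_prod g :
  exists s, [/\ size s = norm g, [set` s] `<=` S & g = \prod_(a <- s) a].
Proof.
rewrite /word_norm /word_dist; case: pselect => [h|[]]; last first.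
  have [s sS gE] := genS g; exists (size s); apply/asboolP.
  by exists s; split=> //; rewrite mul1g.
by case: ex_minnP => k /asboolP[s [<- sS ->]] _; exists s; rewrite mul1g.
Qed.

Lemma word_normM g h : (norm (g * h) <= norm g + norm h)%N.
Proof.
have [s [<- sS ->]] := word_norm_prod g.
have [t [<- tS ->]] := word_norm_prod h.
rewrite -big_cat -size_cat; apply: word_norm_le => x /=.
by rewrite mem_cat => /orP[/sS|/tS].
Qed.

Lemma word_norm_eq0 g : norm g = 0%N -> g = 1.
Proof.
by have [[|a s] [<- _ ->]] := word_norm_prod g; rewrite // big_nil.
Qed.

Lemma word_norm_gt0 g : g != 1 -> (0 < norm g)%N.
Proof. by apply: contra_neqT; rewrite -eqn0Ngt => /eqP /word_norm_eq0. Qed.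

(** Cut a shortest word for [g] after [m] letters: by subadditivity neither piece can have norm
    below its length. *)
Lemma word_norm_split m g : (m <= norm g)%N ->
  exists p : G * G,
    [/\ g = p.1 * p.2, norm p.1 = m & (norm p.2 = norm g - m)%N].
Proof.
have [s [sg sS gE]] := word_norm_prod g => mg.
pose a := \prod_(x <- take m s) x; pose b := \prod_(x <- drop m s) x.
have am : (norm a <= m)%N.
  apply: leq_trans (word_norm_le _) _; last by rewrite size_take_min geq_minl.
  by move=> x /mem_take /sS.
have bm : (norm b <= norm g - m)%N.
  apply: leq_trans (word_norm_le _) _; last by rewrite size_drop sg.
  by move=> x /mem_drop /sS.
have gab : g = a * b by rewrite -big_cat cat_take_drop.
have := word_normM a b; rewrite -gab => gm.
by exists (a, b); split=> //=; lia.
Qed.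

Hypothesis finS : finite_set S.

Lemma finite_word_ball n : finite_set (word_ball S n).
Proof.
have fin k : finite_set [set g | exists s : seq G,
    [/\ size s = k, [set` s] `<=` S & g = \prod_(a <- s) a]].
  elim: k => [|k IHk].
    apply: (@sub_finite_set _ _ _ _ (finite_set1 (1 : G))).
    move=> g [[|a s] [] //= _ _ ->].
    by rewrite big_nil.
  apply: (@sub_finite_set _ _ _ _ (finite_image2 (fun x y => x * y) finS IHk)).
  move=> _ [[|a s] [] //= [sk] sS ->]; rewrite big_cons.
  exists a; first by apply: sS; rewrite /= mem_head.
  exists (\prod_(x <- s) x) => //; exists s; split=> // x /= xs.
  by apply: sS; rewrite /= inE xs orbT.
have -> : word_ball S n = \bigcup_(k in `I_n.+1) [set g | norm g = k].
  by apply/seteqP; split=> [g /= ng|g [k + gk]];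
    [exists (norm g)|rewrite /= -gk ltnS].
apply: bigcup_finite => // k _; apply: (@sub_finite_set _ _ _ _ (fin k)) => g <-.
exact: word_norm_prod.
Qed.

End WordNorm.

(** * Convergence of the series of [x ^+ |g|] over a group *)

Section SphereSeries.
Variables (R : realType) (G : groupType) (S : set G).
Hypotheses (genS : generates S) (finS : finite_set S).
Local Notation norm := (word_norm S).
Local Notation sphere m := [set g : G | norm g = m].
Local Open Scope ereal_scope.

Local Notation weight x := (fun g : G => ((x : R) ^+ norm g)%:E).

Lemma finite_sphere m : finite_set (sphere m).
Proof.
by apply: (@sub_finite_set _ _ _ _ (finite_word_ball genS finS m)) => g /= gm;
  rewrite /word_ball /= gm.
Qed.

Lemma sphere_weightE (x : R) m : (0 <= x)%R ->
  \esum_(g in sphere m) weight x g = (#|` fset_set (sphere m)|%:R * x ^+ m)%:E.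
Proof.
move=> x0; rewrite -esum_cst ?exprn_ge0 //; last exact: finite_sphere.
by apply: eq_esum => g ->.
Qed.

(* Splitting off the first [m] letters bounds the sum over the ball of radius
   [N + m] by a constant plus [q] times the sum over the ball of radius [N],
   where [q < 1] is the sum over the sphere of radius [m]. *)
Lemma sphere_series_lty (y : R) m : (0 <= y)%R ->
  \esum_(g in sphere m) weight y g < 1 -> \esum_(g in setT) weight y g < +oo.
Proof.
move=> y0; set q := esum _ _ => q1.
have w0 g : 0 <= weight y g by rewrite lee_fin exprn_ge0.
have q0 : 0 <= q by exact: esum_ge0.
have qfin : q \is a fin_num by rewrite ge0_fin_numE // (lt_trans q1) // ltry.
pose E N := \esum_(g in word_ball S N) weight y g.
have E0 N : 0 <= E N by exact: esum_ge0.
have Efin N : E N \is a fin_num.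
  rewrite /E esum_fset //; last exact: finite_word_ball.
  by rewrite fsbig_finite ?sumEFin //; exact: finite_word_ball.
have step N : E (N + m)%N <= E m + q * E N.
  pose A := [set g | (m <= norm g <= N + m)%N].
  have AE : \esum_(g in A) weight y g <= q * E N.
    (* A chosen splitting determines [g] as the product of its pair, so [f] is injective on [A] and
       maps it into the product of a sphere and a ball. *)
    have /choice[f fP] g : exists p : G * G, A g ->
        [/\ g = (p.1 * p.2)%g, norm p.1 = m & norm p.2 = (norm g - m)%N].
      have [mg|gm] := leqP m (norm g).
        by have [p pP] := word_norm_split genS mg; exists p.
      by exists (1, 1)%g => /andP[]; rewrite leqNgt gm.
    pose phi (p : G * G) := weight y p.1 * weight y p.2.
    have -> : \esum_(g in A) weight y g = \esum_(g in A) phi (f g).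
      apply: eq_esum => g Ag; have [_ fm fn] := fP g Ag.
      by rewrite /phi -EFinM -exprD fm fn subnKC //; case/andP: Ag.
    rewrite -(@esum_image R _ _ A f phi); last first.
      move=> g h /set_mem Ag /set_mem Ah fgh.
      by have [-> _ _] := fP g Ag; have [-> _ _] := fP h Ah; rewrite fgh.
    rewrite -esum_esumM // esum_esum; last by move=> *; exact: mule_ge0.
    apply: subset_esum => _ [g Ag <-]; have [_ fm fn] := fP g Ag.
    by split=> //=; rewrite /word_ball /= fn leq_subLR addnC; case/andP: Ag.
  apply: le_trans (leeD (lexx _) AE); apply: le_trans (esumU_le _ _ _) => //.
  apply: subset_esum => g; rewrite /word_ball /A /= => gN.
  by have [?|/ltnW ?] := leqP (norm g) m; [left|right; apply/andP].
(* As [E] is nondecreasing, [step] gives [E N <= E m + q * E N]; [C] comes from solving for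
   [E N]. *)
pose C := (fine (E m) / (1 - fine q))%R.
have q1' : (0 < 1 - fine q)%R by rewrite subr_gt0 -lte_fin fineK.
have EC N : E N <= C%:E.
  have : E N <= E m + q * E N.
    apply: le_trans (step N); apply: subset_esum => g.
    by rewrite /word_ball /= => /leq_trans; apply; exact: leq_addr.
  rewrite -(fineK (Efin N)) -(fineK (Efin m)) -(fineK qfin) -EFinM -EFinD.
  rewrite !lee_fin /C ler_pdivlMr // => h; lra.
apply: (@le_lt_trans _ _ C%:E); last exact: ltry.
apply: ge_ereal_sup => _ [X [finX _] <-].
rewrite -esum_fset //.
apply: le_trans (EC (\max_(g <- fset_set X) norm g)%N).
apply: subset_esum => g Xg; rewrite /word_ball /=.
by apply: leq_bigmax_seq; rewrite // in_fset_set // inE.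
Qed.

(** If all spheres of positive radius had weight at least 1, their disjoint union would have
    infinite weight. *)
Lemma sphere_weight_lt1 (x : R) : (0 <= x)%R ->
  \esum_(g in [set~ 1%g]) weight x g < +oo ->
  exists2 m, (0 < m)%N & \esum_(g in sphere m) weight x g < 1.
Proof.
move=> x0 Foo; apply: contrapT => h.
suff F1 : \esum_(g in \bigcup_n sphere n.+1) weight x g = +oo.
  move: Foo; apply/negP; rewrite -leNgt -F1.
  apply: subset_esum => g [n _ /= gn] g1.
  by move: gn; rewrite g1 word_norm1.
apply: esum_pinfty => [g||n].
- by rewrite lee_fin exprn_ge0.
- by move=> i j _ _ [g [/= -> []]].
- by rewrite leNgt; apply/negP => hn; apply: h; exists n.+1.
Qed.

(** The weight of a single sphere is a monomial [c * x ^+ m]; if it is below 1 at [x], it stays so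
    slightly to the right, where [sphere_series_lty] applies. *)
Lemma sphere_series_ext (x : R) : (0 <= x)%R ->
  \esum_(g in [set~ 1%g]) weight x g < +oo ->
  exists2 y : R, (x < y)%R & \esum_(g in [set~ 1%g]) weight y g < +oo.
Proof.
move=> x0 /(sphere_weight_lt1 x0)[m m0]; rewrite sphere_weightE // lte_fin.
set c := _%:R => cx.
have cc : {for x, continuous (fun y : R => c * y ^+ m)%R}.
  by apply: continuousM; [exact: cst_continuous|exact: exprn_continuous].
have cr : (fun y : R => c * y ^+ m)%R @ x^'+ --> (c * x ^+ m)%R.
  exact: cvg_at_right_filter cc.
have /filter_ex[y [xy cy]] :
    \forall y \near x^'+, (x < y)%R /\ (c * y ^+ m < 1)%R.
  by apply: filterI; [exact: nbhs_right_gt|exact: (cvgr_lt _ cr _ cx)].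
have y0 := le_trans x0 (ltW xy).
exists y => //; apply: le_lt_trans (@sphere_series_lty y m y0 _).
  by apply: subset_esum.
by rewrite sphere_weightE // lte_fin.
Qed.

End SphereSeries.

Lemma exprn_convex (R : realDomainType) (x y t : R) n :
  0 <= x -> x <= y -> 0 <= t <= 1 ->
  ((1 - t) * x + t * y) ^+ n <= (1 - t) * x ^+ n + t * y ^+ n.
Proof.
move=> x0 xy /andP[t0 t1]; have y0 := le_trans x0 xy.
have u0 : 0 <= 1 - t by rewrite subr_ge0.
elim: n => [|n IHn]; first by rewrite !expr0; lra.
rewrite exprS; apply: le_trans (ler_wpM2l _ IHn) _.
  by rewrite addr_ge0 ?mulr_ge0.
(* This is exactly the gap between the two sides in the induction step. *)
have : 0 <= (1 - t) * t * ((y - x) * (y ^+ n - x ^+ n)).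
  by rewrite !mulr_ge0 // subr_ge0 // lerXn2r.
rewrite !exprS; nra.
Qed.

(** * The point where a power series takes the value 1 *)

Section PowerSeriesRoot.
Variables (R : realType) (T : choiceType) (P : set T) (k : T -> nat).

Local Open Scope ereal_scope.

Let Z (x : R) := \esum_(g in P) (x ^+ k g)%:E.

Let w0 (x : R) : (0 <= x)%R -> forall g, 0 <= (x ^+ k g)%:E.
Proof. by move=> x0 g; rewrite lee_fin exprn_ge0. Qed.

(** A finite partial sum exceeding 1 at [x] would, by continuity, exceed 1 at some nearby [y] with
    [Z y <= 1]. *)
Lemma power_series_lsc (x : R) :
  (forall e : R, (0 < e)%R -> exists y : R,
    [/\ (x - e < y)%R, (0 <= y <= x)%R & Z y <= 1]) ->
  Z x <= 1.
Proof.
move=> h; apply: ge_ereal_sup => _ [X [finX XP] <-].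
rewrite fsbig_finite // sumEFin lee_fin leNgt; apply/negP => X1.
pose p (y : R) := (\sum_(g <- fset_set X) y ^+ k g)%R.
have pc : {for x, continuous p}.
  have : continuous p by apply: continuous_big => [|g _];
    [exact: add_continuous|exact: exprn_continuous].
  exact.
have /nbhs_ballP[e /= e0 he] : \forall y \near x, (1 < p y)%R.
  exact: (cvgr_gt _ pc _ X1).
have [y [xy /andP[y0 yx] Zy]] := h e e0.
have : (1 < p y)%R by apply: he; rewrite /ball /= ger0_norm; lra.
apply/negP; rewrite -leNgt -lee_fin; apply: le_trans Zy.
rewrite -sumEFin -fsbig_finite // -esum_fset //; first exact: subset_esum.
by move=> g _; exact: w0.
Qed.

Lemma power_series_root :
  (forall g, P g -> (0 < k g)%N) ->
  (forall x : R, (0 <= x)%R -> Z x < +oo -> exists2 y, (x < y)%R & Z y < +oo) ->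
  1 < Z 1 -> exists2 x, (0 < x < 1)%R & Z x = 1.
Proof.
move=> k0 ext Z1.
have Z0 : Z 0 = 0 by rewrite /Z esum1 // => g /k0; rewrite expr0n; case: (k g).
pose A := [set x : R | (0 <= x)%R /\ Z x <= 1].
have A0 : A 0%R by split=> //; rewrite Z0.
have A1 x : A x -> (x < 1)%R.
  move=> [x0 Zx]; rewrite ltNge; apply/negP => x1; move: Z1; apply/negP.
  rewrite -leNgt; apply: le_trans Zx; apply: le_esum => g _.
  by rewrite lee_fin expr1n exprn_ege1.
have supA : has_sup A by split; [exists 0%R|exists 1%R => x /A1 /ltW].
pose x := sup A.
have x0 : (0 <= x)%R by apply: ub_le_sup => //; case: supA.
have Zx : Z x <= 1.
  apply: power_series_lsc => e e0; have [y Ay xy] := sup_adherent e0 supA.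
  exists y; case: (Ay) => y0 Zy; split=> //; rewrite y0 /=.
  by apply: ub_le_sup => //; case: supA.
have Zx1 : Z x = 1.
  apply/eqP; rewrite eq_le Zx leNgt; apply/negP => Zlt.
  have [|y xy Zy] := ext x x0; first by rewrite (lt_trans Zlt) // ltry.
  have y0 := le_trans x0 (ltW xy).
  have Zx0 : 0 <= Z x by apply: esum_ge0 => g _; exact: w0.
  have Zy0 : 0 <= Z y by apply: esum_ge0 => g _; exact: w0.
  have Zxfin : Z x \is a fin_num by rewrite ge0_fin_numE // (lt_trans Zlt) // ltry.
  have Zyfin : Z y \is a fin_num by rewrite ge0_fin_numE.
  pose a := fine (Z x); pose b := fine (Z y).
  have a1 : (a < 1)%R by rewrite -lte_fin fineK.
  have a0 : (0 <= a)%R by exact: fine_ge0.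
  have b0 : (0 <= b)%R by exact: fine_ge0.
  (* The convexity bound at [z] is [a + t * (b - a)], which is at most [a + t * (1 + b) = 1]; so [z]
     lies in [A] beyond its supremum. *)
  pose t := ((1 - a) / (1 + b))%R.
  have tE : (t * (1 + b) = 1 - a)%R by rewrite divfK // lt0r_neq0 //; lra.
  have t0 : (0 < t)%R by rewrite divr_gt0 //; lra.
  have t1 : (t <= 1)%R by nra.
  pose z := ((1 - t) * x + t * y)%R.
  have xz : (x < z)%R by rewrite /z; nra.
  have : (z <= x)%R.
    apply: ub_le_sup; first by case: supA.
    split; first by rewrite (le_trans x0) // ltW.
    apply: (@le_trans _ _ (\esum_(g in P)
        ((1 - t)%:E * (x ^+ k g)%:E + t%:E * (y ^+ k g)%:E))).
      apply: le_esum => g _; rewrite -!EFinM -EFinD lee_fin; apply: exprn_convex => //.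
        exact: ltW.
      by rewrite t1 ltW.
    rewrite esumD; last 2 first.
    - by move=> g _; rewrite mule_ge0 ?w0 // lee_fin subr_ge0.
    - by move=> g _; rewrite mule_ge0 ?w0 // lee_fin ltW.
    rewrite !esumZl ?lee_fin ?subr_ge0 ?(ltW t0) //; try exact: w0.
    rewrite -/(Z x) -/(Z y) -(fineK Zxfin) -(fineK Zyfin) -!EFinM -EFinD lee_fin.
    rewrite -/a -/b; nra.
  by rewrite leNgt xz.
exists x => //; apply/andP; split; last by apply: A1; split.
rewrite lt_neqAle x0 andbT; apply/eqP => xE; move: Zx1; rewrite -xE Z0.
by move/eqP; rewrite eq_sym onee_eq0.
Qed.

End PowerSeriesRoot.

(** * Word norm and reduced words in the free product *)

Section FreeProductNorm.
Variables (G1 G2 : groupType) (S1 : set G1) (S2 : set G2).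
Hypotheses (genS1 : generates S1) (genS2 : generates S2).
Local Notation L := (G1 + G2)%type.
Local Notation fp := (free_product G1 G2).
Local Notation S := (free_product_gen S1 S2).
Implicit Types (l : L) (w : seq L) (g h u : fp).
Local Open Scope group_scope.

Definition letter_norm l : nat :=
  match l with inl a => word_norm S1 a | inr b => word_norm S2 b end.

Local Notation norm := (word_norm S).
Local Notation wnorm w := (\sum_(l <- w) letter_norm l)%N.

Lemma word_of_letterM l g : word_of (fp_letter l * g) = lmul l (word_of g).
Proof. by case: l => a; rewrite ?fp_inl_mulE ?fp_inr_mulE. Qed.

Lemma fp_inl1 : fp_inl G2 (1 : G1) = 1.
Proof. by apply: val_inj => /=; rewrite eqxx. Qed.

Lemma fp_inr1 : fp_inr G1 (1 : G2) = 1.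
Proof. by apply: val_inj => /=; rewrite eqxx. Qed.

Lemma fp_letter_prod l : exists s : seq fp,
  [/\ size s = letter_norm l, [set` s] `<=` S & fp_letter l = \prod_(a <- s) a].
Proof.
case: l => a /=.
  have [s [<- sS ->]] := word_norm_prod genS1 a.
  exists (map (@fp_inl G1 G2) s); split; first by rewrite size_map.
    by move=> _ /mapP[b /sS Sb ->]; left; exists b.
  by rewrite big_map (big_morph _ (@fp_inlM G1 G2) fp_inl1).
have [s [<- sS ->]] := word_norm_prod genS2 a.
exists (map (@fp_inr G1 G2) s); split; first by rewrite size_map.
  by move=> _ /mapP[b /sS Sb ->]; right; exists b.
by rewrite big_map (big_morph _ (@fp_inrM G1 G2) fp_inr1).
Qed.

Lemma fp_word_prod w : exists s : seq fp,
  [/\ size s = wnorm w, [set` s] `<=` S &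
      \prod_(l <- w) fp_letter l = \prod_(a <- s) a].
Proof.
elim: w => [|l w [s [sw sS sE]]]; first by exists [::]; rewrite !big_nil.
have [t [tl tS tE]] := fp_letter_prod l.
exists (t ++ s); rewrite size_cat tl sw big_cons big_cat -sE -tE big_cons.
by split=> // x /=; rewrite mem_cat => /orP[/tS|/sS].
Qed.

Lemma free_product_generates : generates S.
Proof.
move=> g; have [s [_ sS sE]] := fp_word_prod (word_of g).
by exists s; rewrite // -sE -fp_wordE.
Qed.

(** When [l] merges with the head of [w], this is the triangle inequality in the common factor. *)
Lemma lmul_norm l w : (wnorm (lmul l w) <= letter_norm l + wnorm w)%N.
Proof.
have H1 a b := word_normM genS1 a b; have H2 a b := word_normM genS2 a b.
by case: l w => [a|a] [|[b|b] w] /=; case: ifP => _;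
  rewrite ?big_cons ?big_nil /= ?leq_addl //;
  rewrite addnA ?leq_add2r ?leq_addl.
Qed.

(** Spelling out each letter by a shortest word gives one inequality; for the other, multiplying by
    a generator raises the sum of the letter norms by at most 1. *)
Lemma word_norm_fp g : norm g = wnorm (word_of g).
Proof.
apply/eqP; rewrite eqn_leq; apply/andP; split.
  have [s [<- sS sE]] := fp_word_prod (word_of g).
  by rewrite {1}[g]fp_wordE sE; exact: word_norm_le.
have [s [<- sS ->]] := word_norm_prod free_product_generates g.
elim: s sS => [|a s IHs] sS; first by rewrite !big_nil.
have {}IHs : (wnorm (word_of (\prod_(x <- s) x)%g) <= size s)%N.
  by apply: IHs => x xs; apply: sS; rewrite /= inE xs orbT.
have [l -> l1] : exists2 l, a = fp_letter l & (letter_norm l <= 1)%N.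
  have norm1 (G : groupType) (X : set G) b : X b -> (word_norm X b <= 1)%N.
    move=> Xb; have := @word_norm_le _ X [:: b]; rewrite big_seq1; apply => x /=.
    by rewrite inE => /eqP ->.
  have [[b Sb <-]|[b Sb <-]] : S a by apply: sS; rewrite /= mem_head.
    by exists (inl b) => //=; exact: norm1.
  by exists (inr b) => //=; exact: norm1.
rewrite big_cons word_of_letterM; apply: leq_trans (lmul_norm _ _) _.
by rewrite /= -add1n leq_add.
Qed.

Definition side l : bool := if l is inl _ then true else false.

Definition letters (i : bool) : set L :=
  [set l | side l = i /\ ~~ letter_trivial l].

(** The empty word starts on both sides, so that recursions on the number of letters begin at the
    identity for either [i]. *)
Definition starts (i : bool) w : bool :=
  if w is l :: _ then side l == i else true.

Definition words (i : bool) (k : nat) : set fp :=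
  [set g | size (word_of g) = k /\ starts i (word_of g)].

Lemma words0 i : words i 0 = [set 1].
Proof.
apply/seteqP; split=> [g [/size0nil g0 _]|_ ->] //.
exact: val_inj.
Qed.

Lemma word_of_cons i k l u : letters i l -> words (~~ i) k u ->
  word_of (fp_letter l * u) = l :: word_of u.
Proof.
move=> [li l1] [_ ui]; rewrite word_of_letterM.
move: li l1 ui; case: l => a /= <- /negPf a1; rewrite /= ?a1.
  by case: (word_of u) => [|[b|b] w]; rewrite /= ?a1.
by case: (word_of u) => [|[b|b] w]; rewrite /= ?a1.
Qed.

(** Removing the first letter is the source of every recursion on series over words. *)
Lemma words_cons i k :
  set_bij (letters i `*`` (fun=> words (~~ i) k)) (words i k.+1)
    (fun p => fp_letter p.1 * p.2).
Proof.
split.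
- move=> [l u] [/= Ll Wu]; suff : words i k.+1 (fp_letter l * u) by [].
  by split; rewrite (word_of_cons Ll Wu) /=; case: Ll Wu => [li _] [uk _];
    rewrite ?uk ?li.
- move=> [l u] [m v] /set_mem[/= Ll Wu] /set_mem[/= Lm Wv].
  move=> /(congr1 (@word_of _ _)).
  rewrite (word_of_cons Ll Wu) (word_of_cons Lm Wv) => -[-> uv].
  by congr pair; exact: val_inj.
- move=> [[|l w] hw] [/= sw /eqP lw] //.
  have [/andP[l1 _] _] := andP hw.
  have Ll : letters i l by [].
  have wl : starts (~~ i) w.
    case: w {l1 sw} hw => // m w /andP[_ /= /andP[lm _]].
    by move: lm lw; case: l {Ll} => ?; case: m => ? //= _ <-.
  pose u := FreeProduct (reduced_behead hw).
  have Wu : words (~~ i) k u by split; [case: sw|].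
  exists (l, u); first by split.
  by apply: val_inj; exact: word_of_cons Ll Wu.
Qed.

Lemma word_norm_cons i k l u : letters i l -> words (~~ i) k u ->
  norm (fp_letter l * u) = (letter_norm l + norm u)%N.
Proof.
by move=> Ll Wu; rewrite !word_norm_fp (word_of_cons Ll Wu) big_cons.
Qed.

Lemma letter_norm_gt0 i l : letters i l -> (0 < letter_norm l)%N.
Proof. by case: l => a [_ /= a1]; exact: word_norm_gt0. Qed.

Lemma size_word_of_le g : (size (word_of g) <= norm g)%N.
Proof.
rewrite word_norm_fp; have /andP[/allP h _] := word_of_reduced g.
rewrite -sum1_size big_seq [leqRHS]big_seq; apply: leq_sum => l /h l1.
by apply: (@letter_norm_gt0 (side l)).
Qed.

End FreeProductNorm.

(** * Generating series of letters and words, and the critical weight *)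

Section WordSeries.
Variables (R : realType) (G1 G2 : groupType) (S1 : set G1) (S2 : set G2).
Hypotheses (genS1 : generates S1) (genS2 : generates S2).
Hypotheses (finS1 : finite_set S1) (finS2 : finite_set S2).
Local Notation L := (G1 + G2)%type.
Local Notation fp := (free_product G1 G2).
Local Notation S := (free_product_gen S1 S2).
Local Notation norm := (word_norm S).
Local Notation lnorm := (letter_norm S1 S2).
Local Notation genS := (free_product_generates genS1 genS2).
Implicit Types (x y : R) (i : bool).
Local Open Scope ereal_scope.

Lemma esum_words_cons i k (f : fp -> \bar R) : (forall g, 0 <= f g) ->
  \esum_(g in words i k.+1) f g =
  \esum_(l in (letters i : set L))
    \esum_(u in words (~~ i) k) f (fp_letter l * u)%g.
Proof.
move=> f0; rewrite (reindex_esum _ _ _ _ (@words_cons G1 G2 i k)).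
by rewrite esum_esum.
Qed.


Definition letter_series i x :=
  \esum_(l in (letters i : set L)) (x ^+ lnorm l)%:E.

Definition word_series i k x :=
  \esum_(g in (words i k : set fp)) (x ^+ norm g)%:E.

Let w0 (T : Type) (n : T -> nat) x : (0 <= x)%R -> forall t, 0 <= (x ^+ n t)%:E.
Proof. by move=> x0 t; rewrite lee_fin exprn_ge0. Qed.

Lemma letter_series_ge0 i x : (0 <= x)%R -> 0 <= letter_series i x.
Proof. by move=> x0; apply: esum_ge0 => t _; exact: w0. Qed.

Lemma word_series0 i x : word_series i 0 x = 1.
Proof. by rewrite /word_series words0 esum_set1 word_norm1 expr0. Qed.

Lemma word_seriesS i k x : (0 <= x)%R ->
  word_series i k.+1 x = letter_series i x * word_series (~~ i) k x.
Proof.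
move=> x0; rewrite /word_series esum_words_cons; last exact: w0.
rewrite -esum_esumM; [|exact: w0|exact: w0].
apply: eq_esum => l Ll; apply: eq_esum => u Wu.
by rewrite (word_norm_cons genS1 genS2 Ll Wu) exprD.
Qed.

Lemma word_series2 x : (0 <= x)%R ->
  word_series true 2 x = letter_series true x * letter_series false x.
Proof. by move=> x0; rewrite !word_seriesS // word_series0 mule1. Qed.

Lemma le_letter_series i x y : (0 <= x <= y)%R ->
  letter_series i x <= letter_series i y.
Proof.
move=> /andP[x0 xy]; apply: le_esum => l _.
by rewrite lee_fin lerXn2r // nnegrE // (le_trans x0).
Qed.

Lemma letter_series_true x : letter_series true x =
  \esum_(a in [set~ 1%g]) (x ^+ word_norm S1 a)%:E.
Proof.
have -> : \esum_(a in [set~ 1%g]) (x ^+ word_norm S1 a)%:E =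
  \esum_(l in (inl : G1 -> L) @` [set~ 1%g]) (x ^+ lnorm l)%:E.
  by rewrite esum_image // => a b _ _ [].
congr esum; apply/seteqP; split=> [[a|a] [] //= _ a1|_ [a /= a1 <-]].
  by exists a => //; exact/eqP.
by split=> //; exact/eqP.
Qed.

Lemma letter_series_false x : letter_series false x =
  \esum_(a in [set~ 1%g]) (x ^+ word_norm S2 a)%:E.
Proof.
have -> : \esum_(a in [set~ 1%g]) (x ^+ word_norm S2 a)%:E =
  \esum_(l in (inr : G2 -> L) @` [set~ 1%g]) (x ^+ lnorm l)%:E.
  by rewrite esum_image // => a b _ _ [].
congr esum; apply/seteqP; split=> [[a|a] [] //= _ a1|_ [a /= a1 <-]].
  by exists a => //; exact/eqP.
by split=> //; exact/eqP.
Qed.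

Lemma letter_series_ext i x : (0 <= x)%R -> letter_series i x < +oo ->
  exists2 y, (x < y)%R & letter_series i y < +oo.
Proof.
move=> x0; case: i; rewrite ?letter_series_true ?letter_series_false => h.
  by have [y ? ?] := sphere_series_ext genS1 finS1 x0 h;
    exists y => //; rewrite letter_series_true.
by have [y ? ?] := sphere_series_ext genS2 finS2 x0 h;
  exists y => //; rewrite letter_series_false.
Qed.

Hypotheses (nontrivial1 : exists g : G1, g != 1%g)
           (nontrivial2 : exists g : G2, g != 1%g).

Lemma letters_neq0 i : exists l : L, letters i l.
Proof.
case: i; [have [g g1] := nontrivial1|have [g g1] := nontrivial2].
  by exists (inl g).
by exists (inr g).
Qed.

Lemma letter_series_gt0 i x : (0 < x)%R -> 0 < letter_series i x.
Proof.
move=> x0; have [l Ll] := letters_neq0 i.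
apply: (@lt_le_trans _ _ (x ^+ lnorm l)%:E); first by rewrite lte_fin exprn_gt0.
apply: (@esum_term_le _ _ (letters i) (fun l => (x ^+ lnorm l)%:E)) => //.
exact: w0 (ltW x0).
Qed.

(** For positive [x] the other letter series is positive, so an infinite one would make the product
    infinite. At 0 every term vanishes. *)
Lemma letter_series_lty i x : (0 <= x)%R -> word_series true 2 x < +oo ->
  letter_series i x < +oo.
Proof.
rewrite le_eqVlt => /orP[/eqP <- _|x0].
  rewrite /letter_series esum1 ?ltry // => l /(letter_norm_gt0 genS1 genS2).
  by rewrite expr0n; case: (lnorm l).
have := letter_series_gt0 (~~ i) x0; have := letter_series_gt0 i x0.
rewrite word_series2 ?ltW // !ltey => i0 ni0; apply: contra => /eqP ioo.
by move: i0 ni0; case: i ioo => /= -> _ ni0; rewrite ?gt0_muley ?gt0_mulye.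
Qed.

Lemma word_series2_ext x : (0 <= x)%R -> word_series true 2 x < +oo ->
  exists2 y, (x < y)%R & word_series true 2 y < +oo.
Proof.
move=> x0 h.
have [y xy yoo] := letter_series_ext x0 (letter_series_lty true x0 h).
have [z xz zoo] := letter_series_ext x0 (letter_series_lty false x0 h).
(* Both letter series are finite at the smaller of the two extended points. *)
have xt : (x < Num.min y z)%R by rewrite lt_min xy.
have t0 := ltW (le_lt_trans x0 xt).
exists (Num.min y z) => //; rewrite word_series2 //.
apply: lte_mul_pinfty; rewrite ?letter_series_ge0 //.
  rewrite ge0_fin_numE ?letter_series_ge0 //; apply: le_lt_trans yoo.
  by apply: le_letter_series; rewrite t0 ge_min lexx.
by apply: le_lt_trans zoo; apply: le_letter_series; rewrite t0 ge_min lexx orbT.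
Qed.

Hypothesis not_both_order2 :
  ~ (([set: G1] #= `I_2)%card /\ ([set: G2] #= `I_2)%card).

Lemma two_nontrivial (G : groupType) : (exists g : G, g != 1%g) ->
  ~ ([set: G] #= `I_2)%card ->
  exists p : G * G, [/\ p.1 != 1%g, p.2 != 1%g & p.1 != p.2].
Proof.
move=> [a a1] h; apply: contrapT => hn; apply: h.
have -> : [set: G] = [set` [fset 1%g; a]%fset].
  apply/seteqP; split=> // b _ /=; rewrite !inE; apply: contrapT => /negP.
  by rewrite negb_or => /andP[b1 ba]; apply: hn; exists (b, a).
apply/card_eq_fsetP.
by rewrite cardfs2 eq_sym a1.
Qed.

(** At 1 the series counts the words [a b]. Two of them exist once some factor has two nontrivial
    elements; with both factors of order 2 there would be only one. *)
Lemma word_series2_gt1 : 1 < word_series true 2 1.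
Proof.
have two (T : choiceType) (A : set T) a b : A a -> A b -> a != b ->
    1 < \esum_(t in A) (1 : \bar R).
  move=> Aa Ab ab.
  apply: (@lt_le_trans _ _ (\esum_(t in [set` [fset a; b]%fset]) (1 : \bar R))).
    by rewrite esum_cst // set_fsetK cardfs2 ab mulr1 lte_fin ltr1n.
  by apply: subset_esum => t /=; rewrite !inE => /orP[] /eqP ->.
have -> : word_series true 2 1 = \esum_(g in (words true 2 : set fp)) (1 : \bar R).
  by apply: eq_esum => g _; rewrite expr1n.
have mem (l m : L) : letters true l -> letters false m ->
    words true 2 (fp_letter l * fp_letter m)%g /\
    word_of (fp_letter l * fp_letter m)%g = [:: l; m].
  move=> Ll Lm; have W0 : words true 0 (1 : fp)%g by rewrite words0.
  have W1 : words false 1 (fp_letter m)%g.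
    have [+ _ _] := @words_cons G1 G2 false 0 => /(_ (m, 1%g)).
    by rewrite /= mulg1; apply.
  have [+ _ _] := @words_cons G1 G2 true 1 => /(_ (l, fp_letter m)) W2.
  split; first exact: W2.
  by rewrite (word_of_cons Ll W1) -[fp_letter m]mulg1 (word_of_cons Lm W0).
have [G1n|G1n] := pselect ([set: G1] #= `I_2)%card.
  have [||[a b] [/= a1 b1 ab]] := @two_nontrivial G2; first exact: nontrivial2.
    by move=> G2n; apply: not_both_order2.
  have [g g1] := nontrivial1.
  have Lg : letters true (inl g : L) by [].
  have La : letters false (inr a : L) by [].
  have Lb : letters false (inr b : L) by [].
  have [Wa wa] := mem _ _ Lg La; have [Wb wb] := mem _ _ Lg Lb.
  apply: two Wa Wb _; apply: contra ab => /eqP /(congr1 (@word_of _ _)).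
  by rewrite wa wb => -[->].
have [[a b] [/= a1 b1 ab]] := two_nontrivial nontrivial1 G1n.
have [g g1] := nontrivial2.
have Lg : letters false (inr g : L) by [].
have La : letters true (inl a : L) by [].
have Lb : letters true (inl b : L) by [].
have [Wa wa] := mem _ _ La Lg; have [Wb wb] := mem _ _ Lb Lg.
apply: two Wa Wb _; apply: contra ab => /eqP /(congr1 (@word_of _ _)).
by rewrite wa wb => -[->].
Qed.

Lemma word_norm_words_gt0 g : words true 2 g -> (0 < norm g)%N.
Proof.
by case=> g2 _; apply: leq_trans (size_word_of_le genS1 genS2 g); rewrite g2.
Qed.

Lemma critical_weight : exists2 x, (0 < x < 1)%R & word_series true 2 x = 1.
Proof.
apply: power_series_root.
- exact: word_norm_words_gt0.
- exact: word_series2_ext.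
- exact: word_series2_gt1.
Qed.

End WordSeries.

(** * The growth rate of the free product *)

Section Growth.
Variables (R : realType) (G1 G2 : groupType) (S1 : set G1) (S2 : set G2).
Hypotheses (genS1 : generates S1) (genS2 : generates S2).
Hypotheses (finS1 : finite_set S1) (finS2 : finite_set S2).
Local Notation L := (G1 + G2)%type.
Local Notation fp := (free_product G1 G2).
Local Notation S := (free_product_gen S1 S2).
Local Notation norm := (word_norm S).
Local Notation Z := (word_series S1 S2).
Local Notation F := (letter_series S1 S2).
Local Notation genS := (free_product_generates genS1 genS2).

Lemma finite_free_product_gen : finite_set S.
Proof. by rewrite finite_setU; split; exact: finite_image. Qed.

Local Notation finS := finite_free_product_gen.

Variable x : R.
Hypotheses (x01 : 0 < x < 1) (Zx : Z true 2 x = 1%E).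
Hypotheses (nontrivial1 : exists g : G1, g != 1%g)
           (nontrivial2 : exists g : G2, g != 1%g).

Let x0 : 0 < x. Proof. by case/andP: x01. Qed.
Let x0' : 0 <= x. Proof. exact: ltW. Qed.

Local Open Scope ereal_scope.

Let w0 (g : fp) : 0 <= (x ^+ norm g)%:E.
Proof. by rewrite lee_fin exprn_ge0. Qed.

Let FF i : F i x * F (~~ i) x = 1.
Proof. by case: i; rewrite /= -?Zx ?(word_series2 genS1 genS2 x0') // muleC. Qed.

(** An informative existential, so that the statement of [Z_le] can refer to the bound. *)
Let FC : { C : R | (1 <= C)%R & forall i, F i x <= C%:E }.
Proof.
have Foo i : F i x \is a fin_num.
  rewrite ge0_fin_numE ?letter_series_ge0 //.
  by apply: letter_series_lty; rewrite // Zx ltry.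
exists (1 + fine (F true x) + fine (F false x))%R.
  by rewrite -addrA lerDl addr_ge0 // fine_ge0 // letter_series_ge0.
move=> i; rewrite -(fineK (Foo i)) lee_fin.
have a0 : (0 <= fine (F true x))%R by rewrite fine_ge0 // letter_series_ge0.
have b0 : (0 <= fine (F false x))%R by rewrite fine_ge0 // letter_series_ge0.
by case: i; lra.
Qed.

Lemma word_series_double n i : Z i n.*2 x = 1.
Proof.
elim: n => [|n IHn]; first exact: word_series0.
by rewrite doubleS !(word_seriesS genS1 genS2) // negbK IHn mule1 FF.
Qed.

(** Letters pair off with total weight 1; for odd [k] one letter series remains. *)
Let Z_le i k : Z i k x <= (sval (sig_of_sig2 FC))%:E.
Proof.
case: FC => C C1 FC' /=; rewrite -(odd_double_half k); case: (odd k) => /=.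
  by rewrite add1n (word_seriesS genS1 genS2) // word_series_double mule1.
by rewrite add0n word_series_double lee_fin.
Qed.

Lemma ball_series_le : exists2 D : R, (0 < D)%R & forall n,
  \esum_(g in word_ball S n) (x ^+ norm g)%:E <= (D * n.+1%:R)%:E.
Proof.
have := Z_le; case: FC => C C1 _ /= ZC.
(* For each number of letters, one [C] for each factor in which the word can start. *)
exists (C + C)%R; first by lra.
pose V n := [set g : fp | (size (word_of g) <= n)%N].
move=> n; apply: (@le_trans _ _ (\esum_(g in V n) (x ^+ norm g)%:E)).
  apply: subset_esum => g /=; apply: leq_trans; exact: size_word_of_le.
elim: n => [|n IHn].
  apply: (@le_trans _ _ (Z true 0 x)); first apply: subset_esum => g; rewrite /V /=.
    by rewrite leqn0 => /nilP g0; split; rewrite g0.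
  by apply: le_trans (ZC _ _) _; rewrite lee_fin; lra.
rewrite -natr1 mulrDr mulr1 !EFinD.
apply: le_trans (leeD IHn (leeD (ZC true n.+1) (ZC false n.+1))).
apply: le_trans (leeD (lexx _) (esumU_le _ _ w0)).
apply: le_trans (esumU_le _ _ w0); apply: subset_esum => g; rewrite /V /=.
rewrite leq_eqVlt => /orP[/eqP gn|]; last by left.
right; case gE: (word_of g) gn => [|l w] // gn.
by case: (boolP (side l)) => sl; [left|right]; split;
  rewrite gE //= ?sl ?(negPf sl).
Qed.

(** The words of each positive even length starting in the first factor already have total weight
    1. *)
Lemma esum_fp_infty : \esum_(g in [set~ 1%g]) (x ^+ norm g)%:E = +oo.
Proof.
apply/eqP; rewrite -leye_eq.
have <- : \esum_(g in \bigcup_n words true n.+1.*2) (x ^+ norm g)%:E = +oo.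
  apply: esum_pinfty => // [i j _ _ [g [[/= gi _] [gj _]]]|n].
    by apply: succn_inj; apply: double_inj; rewrite -gi -gj.
  by rewrite -[leRHS]/(Z true n.+1.*2 x) word_series_double.
by apply: subset_esum => g [n _ [gn _]] g1; rewrite g1 in gn.
Qed.

(** Otherwise the sphere of radius [n] would have weight below 1, and [sphere_series_lty] would
    contradict [esum_fp_infty]. *)
Lemma ball_card_ge n : (0 < n)%N ->
  (1 <= #|` fset_set (word_ball S n)|%fset%:R * x ^+ n)%R.
Proof.
move=> n0; rewrite leNgt; apply/negP => h.
have : \esum_(g in [set g : fp | norm g = n]) (x ^+ norm g)%:E < 1.
  apply: (@le_lt_trans _ _ (\esum_(g in word_ball S n) (x ^+ n)%:E)).
    apply: (@le_trans _ _ (\esum_(g in [set g : fp | norm g = n]) (x ^+ n)%:E)).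
      by apply: le_esum => g ->.
    by apply: subset_esum => g /= gn; rewrite /word_ball /= gn.
  rewrite esum_cst ?exprn_ge0 ?lte_fin //.
  exact: (finite_word_ball genS finS).
move=> /(sphere_series_lty genS finS x0'); apply/negP; rewrite -leNgt.
by rewrite -esum_fp_infty; exact: subset_esum.
Qed.

(** Since [x < 1], each element of the ball has weight at least [x ^+ n]. *)
Lemma ball_card_le : exists2 D : R, (0 < D)%R & forall n,
  (#|` fset_set (word_ball S n)|%fset%:R * x ^+ n <= D * n.+1%:R)%R.
Proof.
have [D D0 hD] := ball_series_le; exists D => // n; rewrite -lee_fin.
apply: le_trans (hD n); rewrite -esum_cst ?exprn_ge0 //; last first.
  exact: (finite_word_ball genS finS).
apply: le_esum => g gn; rewrite lee_fin; apply: ler_wiXn2l => //.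
by apply: ltW; case/andP: x01.
Qed.

Lemma growth_rate_free_product : growth_rate R S = (- ln x)%:E.
Proof.
have [D D0 hD] := ball_card_le.
set b := fun n => #|` fset_set (word_ball S n)|%fset%:R : R.
apply: (cvg_limn_einf_sup _).1; apply: cvg_EFin; first exact: nearW.
apply/cvgrPdist_le => e e0.
(* As [d <= 1], [d * (n + 1) <= 1 + n * d <= expR (n * d)], which absorbs the linear factor of
   [ball_card_le] at cost [d <= e / 2] per step. Past [M], the constant [ln (D / d)] costs at most
   another [e / 2]. *)
pose d := (Num.min 1 (e / 2))%R.
have d0 : (0 < d)%R by rewrite lt_min ltr01 divr_gt0.
have d1 : (d <= 1)%R by rewrite ge_min lexx.
have de : (d <= e / 2)%R by rewrite ge_min lexx orbT.
pose M := (`|ln (D / d)| / (e / 2))%R.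
near=> n.
have n0 : (0 < n)%N by near: n; exact: nbhs_infty_gt.
have n0' : (0 < n%:R :> R)%R by rewrite ltr0n.
have nM : (M <= n%:R)%R by near: n; exact: nbhs_infty_ger.
have xn0 : (0 < x ^+ n)%R by rewrite exprn_gt0.
have b1 : (1 <= b n * x ^+ n)%R by exact: ball_card_ge.
have b0 : (0 < b n)%R by rewrite -(pmulr_lgt0 _ xn0) (lt_le_trans ltr01).
have lnb : (ln (b n * x ^+ n) = ln (b n) + n%:R * ln x)%R.
  by rewrite lnM ?posrE // lnXn // mulr_natl.
have lo : (0 <= ln (b n) + n%:R * ln x)%R by rewrite -lnb ln_ge0.
have hi : (ln (b n) + n%:R * ln x <= ln (D / d) + n%:R * d)%R.
  rewrite -lnb -[X in (_ <= _ + X)%R]expRK -lnM ?posrE ?divr_gt0 ?expR_gt0 //.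
  rewrite ler_ln ?posrE ?mulr_gt0 ?divr_gt0 ?invr_gt0 ?expR_gt0 //.
  apply: le_trans (hD n) _; rewrite -mulrA ler_pM2l // mulrC ler_pdivlMr //.
  apply: le_trans (expR_ge1Dx _); rewrite -natr1 mulrDl mul1r addrC lerD2r //.
have lnD : (ln (D / d) <= n%:R * (e / 2))%R.
  rewrite (le_trans (ler_norm _)) // -ler_pdivrMr // divr_gt0 //.
have -> : (- ln x - ln (b n) / n%:R = - ((ln (b n) + n%:R * ln x) / n%:R))%R.
  by field; rewrite lt0r_neq0.
rewrite normrN ger0_norm ?divr_ge0 ?ler0n // ler_pdivrMr //; nra.
Unshelve. all: by end_near. Qed.

End Growth.

(** * The measure at the critical weight: its powers, drift and entropy *)

Section CriticalMeasure.
Variables (R : realType) (G1 G2 : groupType) (S1 : set G1) (S2 : set G2).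
Hypotheses (genS1 : generates S1) (genS2 : generates S2).
Local Notation L := (G1 + G2)%type.
Local Notation fp := (free_product G1 G2).
Local Notation S := (free_product_gen S1 S2).
Local Notation norm := (word_norm S).
Local Notation lnorm := (letter_norm S1 S2).
Local Notation Z := (word_series S1 S2).
Local Notation F := (letter_series S1 S2).

Variable x : R.
Hypotheses (x01 : 0 < x < 1) (Zx : Z true 2 x = 1%E).

Let x0 : 0 < x. Proof. by case/andP: x01. Qed.
Let x0' : 0 <= x. Proof. exact: ltW. Qed.
Let lnx0 : 0 < - ln x.
Proof. by rewrite oppr_gt0; apply: ln_lt0. Qed.

(** The closed form of the [n]-th convolution power of [mu], which is the case [n = 1]. *)
Definition weighted_words (n : nat) (g : fp) : R :=
  if g \in (words true n.*2 : set fp) then x ^+ norm g else 0.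

Local Notation mu := (weighted_words 1).

Lemma weighted_words_ge0 n g : 0 <= weighted_words n g.
Proof. by rewrite /weighted_words; case: ifP => // _; rewrite exprn_ge0. Qed.

Lemma esum_weighted_words n (f : fp -> \bar R) :
  (\esum_(g in [set: fp]) ((weighted_words n g)%:E * f g) =
   \esum_(g in (words true n.*2 : set fp)) ((x ^+ norm g)%:E * f g))%E.
Proof.
rewrite [RHS]esum_mkcond; apply: eq_esum => g _.
by rewrite /weighted_words; case: ifP => // _; rewrite mul0e.
Qed.

Lemma is_probability_weighted_words : is_probability mu.
Proof.
split; first exact: weighted_words_ge0.
rewrite -Zx; under eq_esum do rewrite -[_%:E]mule1.
by rewrite esum_weighted_words; apply: eq_esum => g _; rewrite mule1.
Qed.

Lemma words2P g : words true 2 g -> exists l m : L,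
  [/\ letters true l, letters false m & g = (fp_letter l * fp_letter m)%g].
Proof.
have [_ _ h1] := @words_cons G1 G2 true 1.
have [_ _ h0] := @words_cons G1 G2 false 0.
move=> /h1[[l u] /= [Ll /h0[[m v] /= [Lm]]]]; rewrite words0 => -> <- <-.
by exists l, m; rewrite mulg1.
Qed.

(** [g] ends in the second factor and a nonempty [u] starts in the first, so nothing merges or
    cancels. *)
Lemma words2_mul k g u : words true 2 g -> words true k u ->
  [/\ words true k.+2 (g * u)%g, word_of (g * u)%g = word_of g ++ word_of u &
      norm (g * u)%g = (norm g + norm u)%N].
Proof.
move=> /words2P[l [m [Ll Lm ->]]] Wu; rewrite -mulgA.
have [h1 _ _] := @words_cons G1 G2 true k.+1.
have [h0 _ _] := @words_cons G1 G2 false k.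
have Wm : words (~~ true) k.+1 (fp_letter m * u)%g by exact: (h0 (m, u)).
have W1 : words (~~ false) 0 (1 : fp)%g by rewrite words0.
have Wm1 : words (~~ true) 1 (fp_letter m)%g.
  have [h _ _] := @words_cons G1 G2 false 0.
  by have := h (m, 1%g); rewrite /= mulg1; apply.
split; first exact: (h1 (l, _)).
- rewrite (word_of_cons Ll Wm) (word_of_cons Lm Wu) (word_of_cons Ll Wm1).
  by rewrite -[fp_letter m]mulg1 (word_of_cons Lm W1).
- rewrite (word_norm_cons genS1 genS2 Ll Wm) (word_norm_cons genS1 genS2 Lm Wu).
  rewrite (word_norm_cons genS1 genS2 Ll Wm1) -[fp_letter m]mulg1.
  by rewrite (word_norm_cons genS1 genS2 Lm W1) word_norm1 addn0 addnA.
Qed.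

Lemma words_split k g : words true k.+2 g ->
  exists h u : fp, [/\ words true 2 h, words true k u & g = (h * u)%g].
Proof.
have [_ _ h1] := @words_cons G1 G2 true k.+1.
have [_ _ h0] := @words_cons G1 G2 false k.
have [f1 _ _] := @words_cons G1 G2 true 1.
have [f0 _ _] := @words_cons G1 G2 false 0.
move=> /h1[[l u] /= [Ll /h0[[m v] /= [Lm Wv]]]] <- <-.
exists (fp_letter l * fp_letter m)%g, v; split=> //; last by rewrite mulgA.
apply: (f1 (l, _)); split=> //=.
by have := f0 (m, 1%g); rewrite /= mulg1 words0; apply.
Qed.

(** The convolution sum at [g] has at most one nonzero term, where [h] consists of the first two
    letters of [g]. *)
Lemma convolution_weighted_words n :
  convolution mu (weighted_words n) = weighted_words n.+1.
Proof.
apply/funext => g; rewrite /convolution.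
have supp h : mu h * weighted_words n (h^-1 * g)%g != 0 ->
    words true 2 h /\ words true n.*2 (h^-1 * g)%g.
  rewrite /weighted_words; case: ifPn => [/set_mem hW|_]; last by rewrite mul0r eqxx.
  by case: ifPn => [/set_mem|_]; last by rewrite mulr0 eqxx.
rewrite [RHS]/weighted_words; case: ifPn => [/set_mem gW|gW]; last first.
  rewrite esum1 // => h _; apply/eqP; rewrite eqe; apply: contraNT gW.
  by move=> /supp[h2 /(words2_mul h2)]; rewrite mulVKg => -[gW _ _]; rewrite inE.
have [h0 [u0 [h2 u2 gE]]] := words_split gW.
have [_ wg ng] := words2_mul h2 u2.
rewrite (@esumID _ _ [set h0]); last first.
  by move=> h _; rewrite lee_fin mulr_ge0 // weighted_words_ge0.
rewrite setTI esum_set1 ?lee_fin ?mulr_ge0 ?weighted_words_ge0 //.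
rewrite esum1 ?adde0 /=; last first.
  move=> h [_ /= hh0]; apply/eqP; rewrite eqe.
  apply: contraPT hh0 => /supp[hW uW]; apply.
  apply: val_inj; have [_ wh _] := words2_mul hW uW; move: wh.
  (* Two admissible factorizations of [g] share their first two letters, hence coincide. *)
  rewrite mulVKg gE wg /= => /(congr1 (take 2)); rewrite !take_size_cat //.
    by case: hW.
  by case: h2.
by rewrite gE mulKg /weighted_words !mem_set // ng exprD.
Qed.

Lemma convolution_power_weighted_words n :
  convolution_power mu n = weighted_words n.
Proof.
elim: n => [|n IHn]; last first.
  rewrite /convolution_power iterS -/(convolution_power mu n) IHn.
  exact: convolution_weighted_words.
apply/funext => g; rewrite /convolution_power /= /weighted_words words0.
have [->|g1] := eqVneq g 1%g; first by rewrite mem_set // word_norm1 expr0.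
by rewrite memNset //; exact/eqP.
Qed.

Local Open Scope ereal_scope.

Let w0 (T : Type) (n : T -> nat) : forall t, 0 <= (x ^+ n t)%:E.
Proof. by move=> t; rewrite lee_fin exprn_ge0. Qed.

(** Formally [x] times the derivative of [word_series] in [x]. *)
Definition length_series i k :=
  \esum_(g in (words i k : set fp)) ((x ^+ norm g)%:E * (norm g)%:R%:E).

Lemma length_series_ge0 i k : 0 <= length_series i k.
Proof. by apply: esum_ge0 => g _; rewrite mule_ge0. Qed.

(** The Leibniz rule for the product in [word_seriesS]. *)
Lemma length_series_cons i k : length_series i k.+1 =
  (\esum_(l in (letters i : set L)) ((x ^+ lnorm l)%:E * (lnorm l)%:R%:E))
    * Z (~~ i) k x
  + F i x * length_series (~~ i) k.
Proof.
rewrite /length_series esum_words_cons; last by move=> g; rewrite mule_ge0.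
rewrite -esum_esumM //; last by move=> l; rewrite mule_ge0.
rewrite -[X in _ + X]esum_esumM //; last by move=> u; rewrite mule_ge0.
rewrite -esumD; last 2 first.
- by move=> l _; apply: esum_ge0 => u _; rewrite !mule_ge0.
- by move=> l _; apply: esum_ge0 => u _; rewrite !mule_ge0.
apply: eq_esum => l Ll; rewrite -esumD; last 2 first.
- by move=> u _; rewrite !mule_ge0.
- by move=> u _; rewrite !mule_ge0.
apply: eq_esum => u Wu; rewrite (word_norm_cons genS1 genS2 Ll Wu).
by rewrite -!EFinM -EFinD exprD natrD; congr EFin; ring.
Qed.

Lemma length_series_double n :
  length_series true n.*2 = n%:R%:E * length_series true 2.
Proof.
(* All series multiplying the derivatives combine to 1 at the critical weight, so the mean length is
   additive over blocks of two letters. *)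
have two k : Z true k x = 1 -> length_series true k.+2 =
    length_series true 2 + length_series true k.
  move=> Zk.
  have FF : F true x * F false x = 1 by rewrite -word_series2 // -Zx.
  have D0 i : 0 <=
      \esum_(l in (letters i : set L)) ((x ^+ lnorm l)%:E * (lnorm l)%:R%:E).
    by apply: esum_ge0 => l _; rewrite mule_ge0.
  have L0 i : length_series i 0 = 0.
    by rewrite /length_series words0 esum_set1 word_norm1 mule0.
  have F0 i : 0 <= F i x by exact: letter_series_ge0.
  rewrite !length_series_cons !(word_seriesS genS1 genS2) //= Zk L0 !word_series0.
  rewrite !mule1 mule0 adde0 ge0_muleDr ?mule_ge0 ?length_series_ge0 //.
  by rewrite (muleA (F true x) (F false x)) FF mul1e addeA.
elim: n => [|n IHn].
  by rewrite mul0e /length_series words0 esum_set1 word_norm1 mule0.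
rewrite doubleS two ?(word_series_double genS1 genS2) // IHn.
rewrite -natr1 EFinD ge0_muleDl ?length_series_ge0 ?lee_fin ?ler0n //.
by rewrite mul1e addeC.
Qed.

Lemma mean_length_weighted_words n :
  mean_length S (weighted_words n) = n%:R%:E * length_series true 2.
Proof.
rewrite -length_series_double /mean_length /length_series -esum_weighted_words.
by apply: eq_esum => g _; rewrite EFinM.
Qed.

(** On the support, minus the logarithm of the mass [x ^+ |g|] is [- ln x] times [|g|]. *)
Lemma entropy_weighted_words n :
  entropy (weighted_words n) = (- ln x)%:E * (n%:R%:E * length_series true 2).
Proof.
rewrite -length_series_double /entropy /length_series -esumZl.
- under eq_esum do rewrite EFinM.
  rewrite (@esum_weighted_words n (fun g => (- ln (weighted_words n g))%:E)).
  apply: eq_esum => g gW; rewrite /weighted_words mem_set // lnXn //.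
  by rewrite -!EFinM; congr EFin; rewrite -mulr_natl; ring.
- by rewrite lee_fin ltW.
- by move=> g; rewrite mule_ge0.
Qed.

Lemma limn_average (K : \bar R) :
  limn (fun n => (n%:R^-1)%:E * (n%:R%:E * K)) = K.
Proof.
(* The inverse of 0 is 0 by convention, so only the terms with [n > 0] are equal to [K]. *)
apply: cvg_lim => //; refine (cvg_near_cst K _); near=> n.
rewrite muleA -EFinM mulVf ?mul1e // pnatr_eq0 -lt0n.
by near: n; exact: nbhs_infty_gt.
Unshelve. all: by end_near. Qed.

Lemma drift_weighted_words : drift S mu = length_series true 2.
Proof.
rewrite /drift; under eq_fun do
  rewrite convolution_power_weighted_words mean_length_weighted_words.
exact: limn_average.
Qed.

Lemma asymptotic_entropy_weighted_words :
  asymptotic_entropy mu = (- ln x)%:E * length_series true 2.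
Proof.
rewrite /asymptotic_entropy; under eq_fun do
  rewrite convolution_power_weighted_words entropy_weighted_words
    (muleCA (- ln x)%:E).
exact: limn_average.
Qed.

Lemma length_series_gt0 : 0 < length_series true 2.
Proof.
apply: (@lt_le_trans _ _ 1) => //; rewrite -Zx; apply: le_esum => g gW.
rewrite -[leLHS]mule1; apply: lee_wpmul2l => //.
by rewrite lee_fin ler1n; exact: word_norm_words_gt0 gW.
Qed.

Lemma exponential_moment_weighted_words :
  (exists2 y : R, (x < y)%R & Z true 2 y < +oo) -> has_exponential_moment S mu.
Proof.
move=> [y xy Zy]; have y0 := lt_trans x0 xy.
(* This exponent turns the weight [x ^+ |g|] into [y ^+ |g|]. *)
exists (ln (y / x)); first by rewrite ln_gt0 // ltr_pdivlMr // mul1r.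
apply: le_lt_trans Zy; under eq_esum do rewrite EFinM.
rewrite (@esum_weighted_words 1 (fun g => (expR (ln (y / x) * (norm g)%:R))%:E)).
apply: le_esum => g _; rewrite -EFinM lee_fin.
rewrite expRM_natr lnK ?posrE ?divr_gt0 //.
by rewrite -exprMn mulrC divfK // lt0r_neq0.
Qed.

Hypotheses (nontrivial1 : exists g : G1, g != 1%g)
           (nontrivial2 : exists g : G2, g != 1%g).

(** A word [a b] has positive mass, whereas its inverse starts in the second factor and has mass
    0. *)
Lemma weighted_words_not_symmetric : ~ symmetric_measure mu.
Proof.
have [a a1] := nontrivial1; have [b b1] := nontrivial2.
pose w : seq (letter G1 G2) := [:: inl a; inr b].
have rw : reduced w by rewrite /reduced /= a1 b1.
pose g : fp := FreeProduct rw.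
move=> /(_ g); rewrite /weighted_words.
rewrite mem_set; last by split.
rewrite memNset; first by move/eqP; rewrite expf_eq0 (gt_eqF x0) andbF.
by case.
Qed.

(** A nonempty product of elements of the support has a positive number of letters, so it is never
    the identity. *)
Lemma weighted_words_not_admissible : ~ admissible mu.
Proof.
rewrite /admissible => /seteqP[_ /(_ 1%g I)] [s [s0 sA]].
have : words true (size s).*2 (\prod_(a <- s) a)%g.
  elim: s sA {s0} => [|a s IHs] sA; first by rewrite big_nil words0.
  have aW : words true 2 a.
    have := sA a; rewrite /= mem_head => /(_ isT); rewrite /weighted_words.
    by case: ifPn => [/set_mem|_]; rewrite ?eqxx.
  have sW := IHs (fun x xs => sA x (mem_behead (s := a :: s) xs)).
  by rewrite big_cons /= doubleS; have [] := words2_mul aW sW.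
move=> [sz _] e; move: sz; rewrite -e /=.
by case: (s) s0.
Qed.

End CriticalMeasure.

(** [not_both_order2] excludes the infinite dihedral group, whose growth rate is 0: there the
    equality would force zero entropy. *)
Theorem proposition6p2 (R : realType) (G1 G2 : groupType)
    (S1 : set G1) (S2 : set G2)
    (nontrivial1 : exists g : G1, g != 1%g)
    (nontrivial2 : exists g : G2, g != 1%g)
    (not_both_order2 : ~ (([set: G1] #= `I_2)%card /\ ([set: G2] #= `I_2)%card))
    (finS1 : finite_set S1) (finS2 : finite_set S2)
    (symS1 : symmetric_set S1) (symS2 : symmetric_set S2)
    (genS1 : generates S1) (genS2 : generates S2) :
  let S := free_product_gen S1 S2 in
  exists mu : free_product G1 G2 -> R,
    [/\ is_probability mu,
        ~ symmetric_measure mu /\ ~ admissible mu,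
        has_exponential_moment S mu,
        asymptotic_entropy mu != 0%E &
        asymptotic_entropy mu = (drift S mu * growth_rate R S)%E].
Proof.
move=> S.
have [x x01 Zx] := critical_weight R genS1 genS2 finS1 finS2
  nontrivial1 nontrivial2 not_both_order2.
have [x0 x1] := andP x01.
exists (weighted_words S1 S2 x 1); split.
- exact: is_probability_weighted_words.
- split; first exact: weighted_words_not_symmetric.
  exact: weighted_words_not_admissible.
- apply: exponential_moment_weighted_words => //.
  by apply: word_series2_ext => //; rewrite ?Zx ?ltry // ltW.
- rewrite asymptotic_entropy_weighted_words // mule_neq0 //.
    by rewrite eqe oppr_eq0 lt_eqF // ln_lt0.
  by rewrite gt_eqF // length_series_gt0.
- rewrite asymptotic_entropy_weighted_words // drift_weighted_words //.
  by rewrite (growth_rate_free_product genS1 genS2 finS1 finS2 x01) // muleC.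
Qed.
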